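(* Let $G$ be a connected simple graph of order $n$ with $m$ edges, not isomorphic to the star $K_{1,n-1}$. Then $\mu_2(G)\ge \frac{2m}{n}$, with equality if and only if $n$ is even and $G\cong K_{n/2,n/2}$.
   Context: The Laplacian matrix of $G$ is $L(G)=D(G)-A(G)$, where $D(G)$ is the diagonal matrix of vertex degrees and $A(G)$ the adjacency matrix; its eigenvalues are $\mu_1(G)\ge\mu_2(G)\ge\cdots\ge\mu_n(G)=0$. $K_{r,s}$ denotes the complete bipartite graph. *)

(* Defs.v *)
From HB Require Import structures.
From mathcomp Require Import all_boot all_order all_algebra.
From mathcomp Require Import polyrcf.

Set Implicit Arguments.
Unset Strict Implicit.
Unset Printing Implicit Defensive.

Import Order.TTheory GRing.Theory Num.Theory.
Local Open Scope ring_scope.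

Record sgraph := SGraph {
  svertex :> finType;
  sedge : rel svertex;
  sedge_sym : symmetric sedge;
  sedge_irrefl : irreflexive sedge
}.

Definition edge_set (G : sgraph) : {set {set G}} :=
  [set A | [exists x : G, exists y : G, sedge x y && (A == [set x; y])]].

Definition degree (G : sgraph) (x : G) : nat := #|[set y : G | sedge x y]|.

(* The empty graph is not connected. *)
Definition connected (G : sgraph) : Prop :=
  (0 < #|G|)%N /\ forall x y : G, connect (@sedge G) x y.

Definition isomorphic (G H : sgraph) : Prop :=
  exists2 f : G -> H, bijective f & {mono f : x y / sedge x y}.

Section CompleteBipartite.
Variables r s : nat.

Definition Krs_rel : rel ('I_r + 'I_s)%type := fun u v =>
  match u, v with
  | inl _, inr _ | inr _, inl _ => true
  | _, _ => false
  end.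

Lemma Krs_sym : symmetric Krs_rel.
Proof. by move=> [?|?] [?|?]. Qed.

Lemma Krs_irrefl : irreflexive Krs_rel.
Proof. by case. Qed.

Definition complete_bipartite : sgraph := SGraph Krs_sym Krs_irrefl.
End CompleteBipartite.

Section Laplacian.
Variable R : rcfType.

(* Rows and columns are indexed by 'I_#|G| through enum_val. *)
Definition adjacency (G : sgraph) : 'M[R]_#|G| :=
  \matrix_(i, j) (sedge (enum_val i) (enum_val j))%:R.

Definition degree_mx (G : sgraph) : 'M[R]_#|G| :=
  diag_mx (\row_i (degree (enum_val i))%:R).

Definition laplacian (G : sgraph) : 'M[R]_#|G| := degree_mx G - adjacency G.

(* All eigenvalues in R, each repeated according to its multiplicity as a root
   of the characteristic polynomial, in nonincreasing order. *)
Definition eigenvalues n (A : 'M[R]_n) : seq R :=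
  let p := char_poly A in
  sort >=%R (flatten [seq nseq (mup x p) x | x <- rootsR p]).

Lemma count_eigenvalues n (A : 'M[R]_n) (x : R) :
  count_mem x (eigenvalues A) = mup x (char_poly A).
Proof.
have p0 : char_poly A != 0 by rewrite monic_neq0 ?char_poly_monic.
rewrite (permP (permEl (perm_sort _ _))) count_flatten -map_comp.
rewrite (eq_map (g := fun y => (y == x) * mup y (char_poly A))%N); last first.
  by move=> y /=; rewrite count_nseq.
rewrite sumnE big_map; have uR := uniq_roots (- cauchy_bound (char_poly A))
  (cauchy_bound (char_poly A)) (char_poly A).
have [xR|xR] := boolP (x \in rootsR (char_poly A)).
  rewrite (bigD1_seq x) //= eqxx mul1n big1 ?addn0 // => y /negPf ->.
  by rewrite mul0n.
rewrite big_seq big1 ?mupNroot //.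
  apply: contra xR => rx.
  by rewrite -(roots_on_rootsR p0) inE /= rx.
by move=> y yR; have [yx|] := eqVneq y x; rewrite ?mul0n // -yx yR in xR.
Qed.

(* Numbered from 1, so that mu G 1 is the largest eigenvalue. *)
Definition mu (G : sgraph) (k : nat) : R := (eigenvalues (laplacian G))`_k.-1.
End Laplacian.

(* Main.v *)
From HB Require Import structures.
Require Import Defs.
From mathcomp Require Import all_boot all_order all_algebra.
From mathcomp Require Import complex zify ring lra.
Set Implicit Arguments.
Unset Strict Implicit.
Unset Printing Implicit Defensive.
Import Order.TTheory GRing.Theory Num.Theory.
Local Open Scope ring_scope.

(** By Courant-Fischer, mu_2 > b as soon as the form x L x^T - b x x^T is
positive definite on some plane.  Put b = 2m/n, the average degree.

If two vertices v, u have degree at least b, take the plane spanned by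
(b-1) e_v - 1_{N(v) \ u} and (b-1) e_u - 1_{N(u) \ v}.  The form is
nonnegative on it, and definite unless both degrees equal b and v, u are either
adjacent without common neighbor or nonadjacent with the same neighborhood.  So
equality forces G to be regular and triangle-free with nonadjacency transitive:
a balanced complete bipartite graph.

Otherwise a single vertex v has degree at least b.  Let k be the maximum degree
of the other vertices.  As G is not a star, G - v has edges, and counting the
edges of G - v at the vertices of degree k yields an edge u w of G - v with
d(u) = k and d(w) >= k - 1, for which the plane spanned by e_v and e_u - e_w
works. *)

(** * Courant-Fischer for the second eigenvalue *)

Section SymmetricMatrix.
Local Open Scope sesquilinear_scope.
Variables (R : rcfType) (n : nat) (A : 'M[R]_n).
Hypothesis A_sym : A^T = A.

Local Notation C := R[i].
Local Notation toC := (map_mx (real_complex R)).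

Definition qform (x : 'rV[R]_n) : R := (x *m A *m x^T) 0 0.
Definition sqnorm (x : 'rV[R]_n) : R := (x *m x^T) 0 0.

Lemma conj_real_complex (r : R) : (real_complex R r)^*%R = real_complex R r.
Proof. by apply/CrealP/complex_realP; exists r. Qed.

Lemma complex_row (z : 'rV[C]_n) : exists x y : 'rV[R]_n, z = toC x + 'i *: toC y.
Proof.
exists (\row_j complex.Re ('Re (z 0 j))), (\row_j complex.Re ('Im (z 0 j))).
apply/rowP => j; rewrite !mxE [LHS]Crect.
by rewrite (RRe_real (Creal_Re _)) (RRe_real (Creal_Im _)).
Qed.

(** The cross terms cancel, because [y *m B *m x^T] is a 1 x 1 matrix and so equals its transpose.
    Hermitian forms over [R[i]] thus reduce to two real ones. *)
Lemma hermitian_form_split (B : 'M[R]_n) (x y : 'rV[R]_n) : B^T = B ->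
  (toC x + 'i *: toC y) *m toC B *m (toC x + 'i *: toC y)^t* =
  toC (x *m B *m x^T + y *m B *m y^T).
Proof.
move=> Bsym.
have -> : (toC x + 'i *: toC y)^t* = toC x^T - 'i *: toC y^T.
  by apply/matrixP=> i j; rewrite !mxE rmorphD rmorphM /= !conj_real_complex conjCi mulNr.
rewrite !mulmxDl !mulmxBr -!scalemxAl -!scalemxAr !scalerA -expr2 sqrCi.
rewrite scaleN1r opprK -!map_mxM /=.
have -> : x *m B *m y^T = y *m B *m x^T.
  by rewrite [LHS]mx11_scalar -tr_scalar_mx -mx11_scalar !trmx_mul trmxK Bsym mulmxA.
by rewrite map_mxD; move: (toC _) (toC _) ('i *: _) => a b c; rewrite -addrA addKr.
Qed.

Lemma char_poly_conj (F : comUnitRingType) (P B : 'M[F]_n) :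
  P \in unitmx -> char_poly (invmx P *m B *m P) = char_poly B.
Proof.
move=> Pu; rewrite /char_poly.
suff -> : char_poly_mx (invmx P *m B *m P) =
    map_mx polyC (invmx P) *m char_poly_mx B *m map_mx polyC P.
  by rewrite !det_mulmx mulrAC -det_mulmx -map_mxM mulVmx // map_mx1 det1 mul1r.
rewrite /char_poly_mx mulmxBr mulmxBl -!map_mxM /=; congr (_ - _).
by rewrite mul_mx_scalar -scalemxAl -map_mxM mulVmx // map_mx1 scalemx1.
Qed.

Lemma mup_prod_XsubC (I : Type) (s : seq I) (d : I -> R) (x : R) :
  mup x (\prod_(i <- s) ('X - (d i)%:P)) = count_mem x [seq d i | i <- s].
Proof.
elim: s => [|i s IHs]; first by rewrite big_nil mupNroot // root1.
rewrite big_cons mupM ?polyXsubC_eq0 ?IHs //=; last first.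
  by rewrite monic_neq0 // monic_prod_XsubC.
by rewrite -(expr1 ('X - _)) mup_XsubCX; case: eqP.
Qed.

(** A real symmetric matrix is Hermitian over [R[i]], so the spectral theorem diagonalizes it
    unitarily with real entries. The list [t] orders the indices to match [eigenvalues A]. *)
Lemma symmetric_diagonalization :
  exists (P : 'M[C]_n) (d : 'I_n -> R) (t : seq 'I_n),
  [/\ P \is unitarymx,
      toC A = P^t* *m diag_mx (\row_i real_complex R (d i)) *m P,
      perm_eq t (enum 'I_n),
      eigenvalues A = [seq d i | i <- t] &
      sorted >=%R [seq d i | i <- t]].
Proof.
have Aherm : toC A \is hermsymmx.
  apply: realsym_hermsym.
    by apply/is_hermitianmxP; rewrite expr0 scale1r map_mx_id // map_trmx A_sym.
  by apply/mxOverP=> i j; rewrite mxE; apply/complex_realP; eexists.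
have := hermitian_normalmx Aherm => /orthomx_spectralP.
have /mxOverP := hermitian_spectral_diag_real Aherm.
set P := spectralmx _; set D := spectral_diag _ => Dreal A_eq.
have Pu : P \is unitarymx by apply: spectral_unitarymx.
pose d i := complex.Re (D 0 i).
have D_eq : D = \row_i real_complex R (d i).
  by apply/rowP=> i; rewrite mxE RRe_real.
have charA : char_poly A = \prod_(i <- enum 'I_n) ('X - (d i)%:P).
  apply: (@map_poly_inj _ _ (real_complex R)); rewrite map_char_poly A_eq.
  rewrite char_poly_conj ?unitarymx_unit // char_poly_trig ?diag_mx_is_trig //.
  rewrite map_prod_XsubC big_enum; apply: eq_bigr => i _.
  by rewrite D_eq !mxE eqxx mulr1n.
exists P, d, (sort (relpre d >=%R) (enum 'I_n)).
have sortE := sort_map (f := d) (leT := >=%R) (enum 'I_n).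
split=> //.
- by rewrite -invmx_unitary // -D_eq.
- by rewrite perm_sort.
(* Two sorted lists agree once their multiplicities do; on both sides these are root multiplicities
   of the characteristic polynomial. *)
- rewrite -sortE; apply/perm_sortP => //.
  + exact: ge_total.
  + by move=> y x z xy yz; exact: le_trans yz xy.
  + by move=> x y /andP[xy yx]; apply/le_anti/andP; split.
  + apply/allP => x _ /=; apply/eqP; rewrite -mup_prod_XsubC -charA.
    by rewrite -count_eigenvalues /eigenvalues (permP (permEl (perm_sort _ _))).
- by rewrite -sortE; apply: sort_sorted; apply: ge_total.
Qed.

Lemma diag_mx_form (c : 'rV[C]_n) (e : 'rV[C]_n) :
  (c *m diag_mx e *m c^t*) 0 0 = \sum_i e 0 i * `|c 0 i| ^+ 2.
Proof.
rewrite mxE; apply: eq_bigr => i _; rewrite mul_mx_diag !mxE normCK.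
by rewrite (mulrC (c 0 i)) mulrA.
Qed.

(** [c] holds the coordinates of x + i y in the eigenbasis; their squared moduli [r i] weigh both
    forms at once. *)
Lemma spectral_weights :
  exists (P : 'M[C]_n) (d : 'I_n -> R) (t : seq 'I_n),
  [/\ P \is unitarymx, perm_eq t (enum 'I_n),
      eigenvalues A = [seq d i | i <- t], sorted >=%R [seq d i | i <- t] &
      forall x y (c := (toC x + 'i *: toC y) *m P^t*)
             (r := fun i => complex.Re (`|c 0 i| ^+ 2)),
      qform x + qform y = \sum_i d i * r i /\
      sqnorm x + sqnorm y = \sum_i r i].
Proof.
have [P [d [t [Pu A_eq t_enum eig_t t_sorted]]]] := symmetric_diagonalization.
exists P, d, t; split=> // x y c r.
have r_eq i : real_complex R (r i) = `|c 0 i| ^+ 2.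
  by rewrite RRe_real // rpredX // normr_real.
have PzE : P *m (toC x + 'i *: toC y)^t* = c^t*.
  by rewrite /c trmx_mul map_mxM trmxCK.
split; apply: (@complexI R); rewrite rmorph_sum /=.
- apply: (@etrans _ _ (toC (x *m A *m x^T + y *m A *m y^T) 0 0)).
    by rewrite !mxE /qform !mxE.
  rewrite -hermitian_form_split // A_eq -!mulmxA PzE !mulmxA diag_mx_form.
  by apply: eq_bigr => i _; rewrite mxE -r_eq -rmorphM.
apply: (@etrans _ _ (toC (x *m 1%:M *m x^T + y *m 1%:M *m y^T) 0 0)).
  by rewrite !mulmx1 /sqnorm !mxE.
rewrite -hermitian_form_split ?trmx1 // map_mx1 mulmx1.
rewrite -[X in X *m _]mulmx1 -(mulVmx (unitarymx_unit Pu)) invmx_unitary //.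
rewrite -!mulmxA PzE mulmxA -[X in X *m _]mulmx1.
rewrite -diag_const_mx diag_mx_form.
by apply: eq_bigr => i _; rewrite mxE mul1r -r_eq.
Qed.

Lemma Re_sqr_norm_ge0 (z : C) : 0 <= complex.Re (`|z| ^+ 2).
Proof. by have := exprn_ge0 2 (normr_ge0 z); rewrite lecE => /andP[]. Qed.

Lemma linear_dependence_in_line (F : fieldType) (a b : F) :
  exists u v : F, (u, v) != (0, 0) /\ u * a + v * b = 0.
Proof.
have [->|a0] := eqVneq a 0.
  by exists 1, 0; rewrite mulr0 mul0r addr0; split=> //; rewrite xpair_eqE oner_eq0.
exists b, (- a); split; last by rewrite mulrC mulNr subrr.
by rewrite xpair_eqE oppr_eq0 (negbTE a0) andbF.
Qed.

(* Courant-Fischer: some complex combination of x and y is orthogonal to the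
   top eigenvector; its real or its imaginary part is the desired vector. *)
Lemma second_eigenvalue_plane (x y : 'rV[R]_n) : (1 < n)%N ->
  exists p q : R, (p, q) != (0, 0) /\
  qform (p *: x + q *: y) <= (eigenvalues A)`_1 * sqnorm (p *: x + q *: y).
Proof.
move=> n1; have [P [d [t [Pu t_enum eig_t t_sorted formE]]]] := spectral_weights.
have size_t : size t = n by rewrite (perm_size t_enum) size_enum_ord.
have x0 : 'I_n := Ordinal (ltnW n1).
pose i0 := nth x0 t 0.
(* An index other than [i0] sits at position 1 or later of the nonincreasing list. *)
have d_le i : i != i0 -> d i <= (eigenvalues A)`_1.
  move=> ii0; have i_t : i \in t by rewrite (perm_mem t_enum) mem_enum.
  have it := i_t; rewrite -index_mem in it.
  have idx : (0 < index i t)%N.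
    by rewrite lt0n; apply: contraNneq ii0 => e; rewrite /i0 -e nth_index.
  rewrite eig_t -[d i](_ : [seq d i | i <- t]`_(index i t) = _); last first.
    by rewrite (nth_map x0) // nth_index.
  apply: (sorted_leq_nth _ _ 0 t_sorted) => //=.
  - by move=> b a c ab bc; exact: le_trans bc ab.
  - by move=> a; exact: lexx.
  - by rewrite ?inE size_map size_t.
  - by rewrite ?inE size_map.
set mu2 := (eigenvalues A)`_1 in d_le *.
have [al [be [albe0 dep]]] := linear_dependence_in_line
  ((toC x *m P^t*) 0 i0) ((toC y *m P^t*) 0 i0).
pose p1 := complex.Re ('Re al); pose p2 := complex.Re ('Im al).
pose q1 := complex.Re ('Re be); pose q2 := complex.Re ('Im be).
have alE : al = real_complex R p1 + 'i * real_complex R p2.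
  by rewrite [LHS]Crect !RRe_real ?Creal_Re ?Creal_Im.
have beE : be = real_complex R q1 + 'i * real_complex R q2.
  by rewrite [LHS]Crect !RRe_real ?Creal_Re ?Creal_Im.
pose X1 := p1 *: x + q1 *: y; pose X2 := p2 *: x + q2 *: y.
have zE : toC X1 + 'i *: toC X2 = al *: toC x + be *: toC y.
  apply/rowP => j; rewrite !mxE !rmorphD !rmorphM alE beE /=.
  by rewrite mulrDr !mulrDl addrACA !mulrA.
have [qE nE] := formE X1 X2.
have sum_le : qform X1 + qform X2 <= mu2 * (sqnorm X1 + sqnorm X2).
  rewrite qE nE mulr_sumr; apply: ler_sum => i _.
  have [->|ii0] := eqVneq i i0; last first.
    by apply: ler_wpM2r; [exact: Re_sqr_norm_ge0 | exact: d_le].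
  by rewrite zE mulmxDl -!scalemxAl !mxE in dep *; rewrite dep normr0 expr0n /= !mulr0.
have zero_form : qform (0 *: x + 0 *: y) = 0 /\ sqnorm (0 *: x + 0 *: y) = 0.
  by rewrite /qform /sqnorm !scale0r addr0 !mul0mx mxE.
(* If (p1, q1) is zero, both forms vanish at [X1] and the bound falls to [X2]. If [X1] violates the
   bound, [X2] satisfies it strictly, which also excludes p2 = q2 = 0. *)
have [le1|lt1] := leP (qform X1) (mu2 * sqnorm X1).
  have [e1|] := eqVneq (p1, q1) (0, 0); last by exists p1, q1.
  exists p2, q2; move: e1 sum_le albe0; rewrite /X1 => -[e11 e12].
  rewrite alE beE e11 e12 !(zero_form.1, zero_form.2) !add0r => ? albe0; split=> //.
  by apply: contraNneq albe0 => -[-> ->]; rewrite !mulr0.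
exists p2, q2.
have lt2 : qform X2 < mu2 * sqnorm X2.
  rewrite mulrDr in sum_le; rewrite -(ltrD2l (qform X1)).
  by apply: le_lt_trans sum_le _; rewrite ltrD2r.
split; last exact: ltW.
apply: contraTneq lt2; rewrite /X2 => -[-> ->].
by rewrite !(zero_form.1, zero_form.2) mulr0 ltxx.
Qed.

(** The plane of the top two eigenvectors contains a nonzero complex vector orthogonal to [w], and
    there the form is at least mu_2 times the squared norm. As [1 < n], index 1 is a genuine entry
    and not the default of [nth]. *)
Lemma second_eigenvalue_le (w : 'cV[R]_n) (b : R) : (1 < n)%N ->
  (forall x : 'rV_n, x *m w = 0 -> qform x <= b * sqnorm x) ->
  (eigenvalues A)`_1 <= b.
Proof.
move=> n1 w_le; have [P [d [t [Pu t_enum eig_t t_sorted formE]]]] := spectral_weights.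
have size_t : size t = n by rewrite (perm_size t_enum) size_enum_ord.
have x0 : 'I_n := Ordinal (ltnW n1).
pose i0 := nth x0 t 0; pose i1 := nth x0 t 1.
have i01 : i0 != i1.
  rewrite nth_uniq ?size_t ?(ltnW n1) //.
  by rewrite (perm_uniq t_enum) enum_uniq.
have d1E : d i1 = (eigenvalues A)`_1.
  by rewrite eig_t (nth_map x0) ?size_t.
have d0_ge : (eigenvalues A)`_1 <= d i0.
  rewrite eig_t -[d i0](_ : [seq d i | i <- t]`_0 = _); last first.
    by rewrite (nth_map x0) ?size_t ?(ltnW n1).
  apply: (sorted_leq_nth _ _ 0 t_sorted) => //=.
  - by move=> u v z uv vz; exact: le_trans vz uv.
  - by move=> u; exact: lexx.
  - by rewrite ?inE size_map size_t ltnW.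
  - by rewrite ?inE size_map size_t.
set mu2 := (eigenvalues A)`_1 in d0_ge d1E *.
have [al [be [albe0 dep]]] := linear_dependence_in_line
  ((row i0 P *m toC w) 0 0) ((row i1 P *m toC w) 0 0).
have [x [y zE]] := complex_row (al *: row i0 P + be *: row i1 P).
have cE : (toC x + 'i *: toC y) *m P^t* = al *: delta_mx 0 i0 + be *: delta_mx 0 i1.
  by rewrite -zE mulmxDl -!scalemxAl -!row_mul (unitarymxP Pu) !row1.
(* Since [w] is real, orthogonality of x + i y to [w] passes to [x] and [y] separately. *)
have [xw yw] : x *m w = 0 /\ y *m w = 0.
  have : toC (x *m w) 0 0 + 'i * toC (y *m w) 0 0 = 0.
    rewrite !map_mxM -[RHS]dep -[toC x](addrK ('i *: toC y)) -zE.
    by rewrite mulmxBl mulmxDl -!scalemxAl !mxE subrK.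
  rewrite !mxE => /eqP; set u := \sum__ _; set v := \sum__ _ => uv0.
  have [u0 v0] : u = 0 /\ v = 0.
    have real_C k : real_complex R k \is Num.real by apply/complex_realP; exists k.
    split; apply: (@complexI R).
      by rewrite -(Re_rect (real_C u) (real_C v)) (eqP uv0) raddf0.
    by rewrite -(Im_rect (real_C u) (real_C v)) (eqP uv0) raddf0.
  by split; rewrite [LHS]mx11_scalar mxE -/u -/v ?u0 ?v0 raddf0.
have [qE nE] := formE x y; rewrite cE in qE nE.
set r := fun i =>
  complex.Re (`|(al *: delta_mx 0 i0 + be *: delta_mx 0 i1 : 'rV_n) 0 i| ^+ 2) in qE nE.
have r_ge0 i : 0 <= r i by exact: Re_sqr_norm_ge0.
(* Weights outside [i0] and [i1] vanish, and [d] is at least [mu2] at both. *)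
have sum_ge : mu2 * (\sum_i r i) <= \sum_i d i * r i.
  rewrite mulr_sumr; apply: ler_sum => i _.
  have [->|ii0] := eqVneq i i0; first exact: ler_wpM2r.
  have [->|ii1] := eqVneq i i1; first by rewrite d1E.
  by rewrite /r !mxE (negbTE ii0) (negbTE ii1) !andbF !mulr0 addr0 normr0 expr0n /= !mulr0.
have r_gt0 : 0 < \sum_i r i.
  have Re_gt0 (z : C) : z != 0 -> 0 < complex.Re (`|z| ^+ 2).
    by rewrite -normr_gt0 => /(exprn_gt0 2); rewrite ltcE => /andP[].
  have [i ri] : exists i, 0 < r i.
    have [al0|al0] := eqVneq al 0.
      exists i1; apply: Re_gt0; rewrite !mxE !eqxx al0 mul0r add0r mulr1.
      by apply: contraNneq albe0 => ->; rewrite al0.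
    by exists i0; apply: Re_gt0; rewrite !mxE !eqxx (negbTE i01) mulr1 mulr0 addr0.
  rewrite (bigD1 i) //=; apply: ltr_wpDr => //; exact: sumr_ge0.
rewrite -(ler_pM2r r_gt0); apply: le_trans sum_ge _.
by rewrite -qE -nE mulrDr lerD // w_le.
Qed.
End SymmetricMatrix.

(** * The Laplacian form *)

Section Energy.
Variables (R : rcfType) (G : sgraph).
Implicit Types (f g : G -> R).

Definition adj (x y : G) : R := (sedge x y)%:R.

(** The Laplacian quadratic form, a sum over edges; [2^-1] compensates for counting each edge in
    both orders. *)
Definition energy f : R := 2^-1 * \sum_x \sum_y adj x y * (f x - f y) ^+ 2.

Definition sqsum f : R := \sum_x f x ^+ 2.

Lemma adjC x y : adj x y = adj y x.
Proof. by rewrite /adj sedge_sym. Qed.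

Lemma degreeE (x : G) : (degree x)%:R = \sum_y adj x y.
Proof.
rewrite /degree -sum1_card natr_sum big_mkcond /=.
by apply: eq_bigr => y _; rewrite inE /adj; case: sedge.
Qed.

Lemma energyE f :
  energy f = \sum_x (degree x)%:R * f x ^+ 2 - \sum_x \sum_y adj x y * (f x * f y).
Proof.
rewrite /energy.
pose S := \sum_x \sum_y adj x y * f x ^+ 2.
have S_sym : \sum_x \sum_y adj x y * f y ^+ 2 = S.
  by rewrite exchange_big; apply: eq_bigr => x _; apply: eq_bigr => y _; rewrite adjC.
have -> : \sum_x (degree x)%:R * f x ^+ 2 = S.
  by apply: eq_bigr => x _; rewrite degreeE mulr_suml.
set T := \sum_x \sum_y _ * (_ * _).
suff -> : \sum_x \sum_y adj x y * (f x - f y) ^+ 2 = S + S - (T + T) by field.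
rewrite -{2}S_sym /S /T -!big_split -sumrB; apply: eq_bigr => x _ /=.
by rewrite -!big_split -sumrB; apply: eq_bigr => y _ /=; ring.
Qed.

Lemma sum_enum_val (F : G -> R) : \sum_(i < #|G|) F (enum_val i) = \sum_x F x.
Proof. by rewrite -(big_enum_val F). Qed.

Lemma qform_laplacian f :
  qform (laplacian R G) (\row_(i < #|G|) f (enum_val i)) = energy f.
Proof.
have -> : energy f = \sum_(j < #|G|)
    ((degree (enum_val j))%:R * f (enum_val j) ^+ 2
     - \sum_(i < #|G|) adj (enum_val j) (enum_val i) * (f (enum_val j) * f (enum_val i))).
  rewrite energyE -sumrB -sum_enum_val; apply: eq_bigr => j _; congr (_ - _).
  by rewrite -sum_enum_val.
rewrite /qform mxE; apply: eq_bigr => j _.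
rewrite [in LHS]mxE mulr_suml !mxE.
under eq_bigr => i _ do rewrite !mxE mulrBr mulrBl.
rewrite sumrB (bigD1 j) //= big1 ?addr0 => [|i ij]; last first.
  by rewrite (negbTE ij) mulr0n mulr0 mul0r.
rewrite eqxx mulr1n mulrAC mulrC -expr2; congr (_ - _).
by apply: eq_bigr => i _; rewrite /adj sedge_sym mulrAC mulrC [f _ * _ in RHS]mulrC.
Qed.

Lemma sqnorm_row f : sqnorm (\row_(i < #|G|) f (enum_val i)) = sqsum f.
Proof.
rewrite /sqsum -(sum_enum_val (fun x => f x ^+ 2)) /sqnorm mxE.
by apply: eq_bigr => i _; rewrite !mxE.
Qed.

Lemma laplacian_sym : (laplacian R G)^T = laplacian R G.
Proof.
rewrite /laplacian linearB /= tr_diag_mx; congr (_ - _).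
by apply/matrixP => i j; rewrite !mxE sedge_sym.
Qed.

Lemma mu2_plane f g : (1 < #|G|)%N ->
  exists p q : R, (p, q) != (0, 0) /\
    energy (fun x => p * f x + q * g x) <= mu R G 2 * sqsum (fun x => p * f x + q * g x).
Proof.
move=> /(second_eigenvalue_plane laplacian_sym
  (\row_(i < #|G|) f (enum_val i)) (\row_(i < #|G|) g (enum_val i))).
move=> [p [q [pq0 le]]]; exists p, q; split=> //.
rewrite -qform_laplacian -sqnorm_row.
suff -> : \row_(i < #|G|) (p * f (enum_val i) + q * g (enum_val i)) =
  p *: (\row_(i < #|G|) f (enum_val i)) + q *: (\row_(i < #|G|) g (enum_val i)) :> 'rV_#|G| by [].
by apply/rowP => i; rewrite !mxE.
Qed.

Lemma mu2_le (w : G -> R) (b : R) : (1 < #|G|)%N ->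
  (forall f, \sum_x w x * f x = 0 -> energy f <= b * sqsum f) -> mu R G 2 <= b.
Proof.
move=> n1 w_le.
apply: (second_eigenvalue_le laplacian_sym
  (w := \col_(i < #|G|) w (enum_val i))) => // x xw.
have -> : x = \row_(i < #|G|) x 0 (enum_rank (enum_val i : G)).
  by apply/rowP => i; rewrite mxE enum_valK.
rewrite (qform_laplacian (fun v => x 0 (enum_rank v))).
rewrite (sqnorm_row (fun v => x 0 (enum_rank v))); apply: w_le.
rewrite -sum_enum_val; move/rowP/(_ 0): xw; rewrite !mxE => xw; apply: etrans xw.
by apply: eq_bigr => i _; rewrite !mxE enum_valK mulrC.
Qed.
End Energy.

(** * Test planes *)

Section TestPlanes.
Variables (R : rcfType) (G : sgraph).
Local Notation adj := (adj R).

(** Multiplying by [s] completes the square and leaves the determinant s t - r^2 as coefficient of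
    q^2. *)
Lemma pos_def2 (s t r p q : R) :
  0 < s -> r ^+ 2 < s * t -> (p, q) != (0, 0) ->
  0 < s * p ^+ 2 + t * q ^+ 2 - 2 * (p * q * r).
Proof.
move=> s0 rst pq0; rewrite -(pmulr_rgt0 _ s0).
have -> : s * (s * p ^+ 2 + t * q ^+ 2 - 2 * (p * q * r)) =
  (s * p - q * r) ^+ 2 + (s * t - r ^+ 2) * q ^+ 2 by ring.
have st0 : 0 < s * t - r ^+ 2 by rewrite subr_gt0.
have [q0|q0] := eqVneq q 0; last first.
  by apply: ltr_wpDl; rewrite ?sqr_ge0 // mulr_gt0 // exprn_even_gt0.
rewrite q0 mul0r subr0 expr0n mulr0 addr0 exprn_even_gt0 //= mulf_neq0 ?(gt_eqF s0) //.
by apply: contraNneq pq0 => ->; rewrite q0.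
Qed.

(** On the plane of e_v and e_u - e_w, the form energy - b sqsum has diagonal entries d(v) - b and
    d(u) + d(w) + 2 - 2b, the 2 coming from the edge u w, and an off-diagonal entry in {-1, 0, 1}.
    The last hypothesis makes its determinant positive. *)
Lemma mu2_gt_of_edge (v u w : G) (b : R) :
  u != v -> w != v -> sedge u w -> b < (degree v)%:R ->
  1 < ((degree v)%:R - b) * ((degree u)%:R + (degree w)%:R + 2 - 2 * b) ->
  b < mu R G 2.
Proof.
move=> uv wv uw bv big; have wu : w != u by apply: contraTneq uw => ->; rewrite sedge_irrefl.
have n1 : (1 < #|G|)%N.
  by rewrite -cardsT; apply/card_gt1P; exists u, v; rewrite !inE.
pose f x : R := (x == v)%:R; pose g x : R := (x == u)%:R - (x == w)%:R.
have [p [q [pq0 le]]] := mu2_plane f g n1.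
set h := fun x => _ in le.
have sumh (K : G -> R) : \sum_x h x * K x = p * K v + q * (K u - K w).
  have delta (z : G) : \sum_x (x == z)%:R * K x = K z.
    rewrite (bigD1 z) //= eqxx mul1r big1 ?addr0 // => x /negbTE ->.
    by rewrite mul0r.
  rewrite -!delta mulr_sumr -sumrB mulr_sumr -big_split.
  by apply: eq_bigr => x _; rewrite /h /f /g /=; ring.
have hv : h v = p by rewrite /h /f /g eqxx ![v == _]eq_sym (negbTE uv) (negbTE wv) /=; ring.
have hu : h u = q by rewrite /h /f /g eqxx [u == w]eq_sym (negbTE uv) (negbTE wu) /=; ring.
have hw : h w = - q by rewrite /h /f /g eqxx (negbTE wv) (negbTE wu) /=; ring.
have sumh2 (c : G -> R) : \sum_x c x * h x ^+ 2 = p ^+ 2 * c v + q ^+ 2 * (c u + c w).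
  rewrite (eq_bigr (fun x => h x * (c x * h x))) => [|x _]; last by ring.
  by rewrite sumh hv hu hw; ring.
have normE : sqsum h = 2 * q ^+ 2 + p ^+ 2.
  have := sumh2 (fun=> 1); under eq_bigr => x _ do rewrite mul1r.
  by rewrite /sqsum => ->; ring.
have energE : energy h = (degree v)%:R * p ^+ 2 + ((degree u)%:R + (degree w)%:R) * q ^+ 2
    + 2 * q ^+ 2 - 2 * (p * q * (adj v u - adj v w)).
  rewrite energyE sumh2.
  have -> : \sum_x \sum_y adj x y * (h x * h y) =
      \sum_x h x * (p * adj x v + q * (adj x u - adj x w)).
    apply: eq_bigr => x _; rewrite -(sumh (adj x)) mulr_sumr.
    by apply: eq_bigr => y _; ring.
  rewrite sumh /adj !sedge_irrefl ![sedge _ v]sedge_sym [sedge w u]sedge_sym uw /=.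
  by ring.
rewrite ltNge; apply/negP => mub.
have : energy h <= b * sqsum h.
  by apply: le_trans le _; apply: ler_wpM2r => //; apply: sumr_ge0 => x _; apply: sqr_ge0.
have r2 : (adj v u - adj v w) ^+ 2 <
    ((degree v)%:R - b) * ((degree u)%:R + (degree w)%:R + 2 - 2 * b).
  apply: le_lt_trans big; rewrite /adj.
  by case: (sedge v u); case: (sedge v w); rewrite /= ?subrr ?subr0 ?sub0r ?sqrrN ?expr1n ?expr0n.
have := pos_def2 (_ : 0 < (degree v)%:R - b) r2 pq0; rewrite subr_gt0 => /(_ bv).
by rewrite energE normE => h1 h2; lra.
Qed.

(* A lower bound for the form on the plane of two vertices of degrees dv and du
   with c common neighbors, adjacent iff e; see energy_pair_form. *)
Definition pair_form (b dv du c : R) (e : bool) (p q : R) : R :=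
  b * (b - 1) * ((dv - e%:R - (b - 1)) * p ^+ 2 + (du - e%:R - (b - 1)) * q ^+ 2)
  + c * (b * (p + q) ^+ 2 - (b - 1) * (p ^+ 2 + q ^+ 2))
  + e%:R * ((b - 1) ^+ 2 * (p - q) ^+ 2).

Lemma sum_diff_sqr_gt0 (x y p q : R) : 0 < x -> 0 < y -> (p, q) != (0, 0) ->
  0 < x * (p + q) ^+ 2 + y * (p - q) ^+ 2.
Proof.
move=> x0 y0 pq0.
have [pq|pq] := eqVneq (p + q) 0; last first.
  apply: ltr_wpDr; first by rewrite mulr_ge0 ?sqr_ge0 // ltW.
  by rewrite mulr_gt0 // exprn_even_gt0.
rewrite pq expr0n mulr0 add0r mulr_gt0 // exprn_even_gt0 //=.
apply: contraNneq pq0 => pq'; apply/eqP; congr (_, _); lra.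
Qed.

(** With h = b - 1, the form is a nonnegative diagonal part plus a combination of (p + q)^2 and (p -
    q)^2. Splitting off d - b when c <= h, and d - c - 1 otherwise, keeps all coefficients
    nonnegative. *)
Lemma pair_form_adj_gt0 (b dv du c p q : R) :
  1 < b -> b <= dv -> b <= du -> 0 <= c -> c + 1 <= dv -> c + 1 <= du ->
  [|| b < dv, b < du | 0 < c] -> (p, q) != (0, 0) ->
  0 < pair_form b dv du c true p q.
Proof.
move=> b1 bv bu c0 cv cu strict pq0; pose h := b - 1.
have h0 : 0 < h by rewrite /h; lra.
have p0 := sqr_ge0 p; have q0 := sqr_ge0 q.
have s0 := sqr_ge0 (p + q); have t0 := sqr_ge0 (p - q).
have Dv0 : 0 <= dv - b by lra.
have Du0 : 0 <= du - b by lra.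
have bE : b = h + 1 by rewrite /h; ring.
have bh0 : 0 < b * h by rewrite mulr_gt0 //; lra.
have [ch|ch] := leP c h; last first.
  have -> : pair_form b dv du c true p q =
      b * h * ((dv - c - 1) * p ^+ 2 + (du - c - 1) * q ^+ 2) +
      ((b * h * (c - h) / 2 + c * (1 + h / 2)) * (p + q) ^+ 2 +
      (h / 2 * (h * (c - h) + h)) * (p - q) ^+ 2).
    by rewrite /pair_form bE /=; field.
  apply: ltr_wpDl.
    by apply: mulr_ge0; [exact: ltW | apply: addr_ge0; apply: mulr_ge0 => //; lra].
  have chp : 0 < c - h by lra.
  apply: sum_diff_sqr_gt0 => //.
    apply: ltr_pwDl; first by rewrite !mulr_gt0 //; lra.
    by rewrite mulr_ge0 //; lra.
  apply: mulr_gt0; first lra.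
  by apply: addr_gt0 => //; apply: mulr_gt0.
have -> : pair_form b dv du c true p q =
    b * h * ((dv - b) * p ^+ 2 + (du - b) * q ^+ 2) +
    (c * (1 + h / 2) * (p + q) ^+ 2 + h * (h - c / 2) * (p - q) ^+ 2).
  by rewrite /pair_form bE /=; field.
have hc : 0 < h * (h - c / 2) by rewrite mulr_gt0 //; lra.
have [c_gt0|c_le0] := ltP 0 c.
  apply: ltr_wpDl.
    by apply: mulr_ge0; [exact: ltW | apply: addr_ge0; apply: mulr_ge0 => //; lra].
  by apply: sum_diff_sqr_gt0 => //; rewrite mulr_gt0 //; lra.
have {}strict : b < dv \/ b < du.
  by case/or3P: strict => [||c_gt0]; [left|right|exfalso; lra].
have -> : c = 0 by apply/le_anti; rewrite c_le0 c0.
rewrite !mul0r add0r subr0.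
(* The remaining square vanishes only on the line p = q, where the strict degree inequality takes
   over. *)
have [pq|pq] := eqVneq p q; last first.
  apply: ltr_wpDl.
    by apply: mulr_ge0; [exact: ltW | apply: addr_ge0; apply: mulr_ge0 => //; lra].
  by rewrite mulr_gt0 ?exprn_even_gt0 ?mulr_gt0 //= subr_eq0.
apply: ltr_wpDr; first by rewrite mulr_ge0 // mulr_ge0 ?ltW.
rewrite mulr_gt0 // pq -mulrDl mulr_gt0 //; first by case: strict => ?; lra.
by rewrite exprn_even_gt0 //=; apply: contraNneq pq0 => q00; rewrite pq q00.
Qed.

(** The form is h (al p^2 + be q^2) + c b (p + q)^2 with al, be >= 0. Strictness forbids al = be =
    0; if just one vanishes, then c = b > 0 and (p + q)^2 covers the degenerate axis. *)
Lemma pair_form_nonadj_gt0 (b dv du c p q : R) :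
  1 < b -> b <= dv -> b <= du -> 0 <= c -> c <= dv -> c <= du ->
  [|| b < dv, b < du | c < b] -> (p, q) != (0, 0) ->
  0 < pair_form b dv du c false p q.
Proof.
move=> b1 bv bu c0 cv cu strict pq0; pose h := b - 1.
have h0 : 0 < h by rewrite /h; lra.
have bE : b = h + 1 by rewrite /h; ring.
pose al := h * (dv - b) + (dv - c); pose be := h * (du - b) + (du - c).
have -> : pair_form b dv du c false p q =
    h * (al * p ^+ 2 + be * q ^+ 2) + c * b * (p + q) ^+ 2.
  by rewrite /pair_form /al /be bE /=; ring.
have al0 : 0 <= al by apply: addr_ge0; [apply: mulr_ge0 => //|]; lra.
have be0 : 0 <= be by apply: addr_ge0; [apply: mulr_ge0 => //|]; lra.
have ge0 : 0 <= c * b * (p + q) ^+ 2.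
  by apply: mulr_ge0; [apply: mulr_ge0 => //; lra | exact: sqr_ge0].
have alP : al = 0 -> dv = b /\ c = b.
  move=> al00; have hD : 0 <= h * (dv - b) by rewrite mulr_ge0 //; lra.
  have /eqP : h * (dv - b) = 0 by rewrite /al in al00; lra.
  rewrite mulf_eq0 (gt_eqF h0) subr_eq0 //= => /eqP dvb; split=> //.
  by move: al00; rewrite /al dvb subrr mulr0 add0r; lra.
have beP : be = 0 -> du = b /\ c = b.
  move=> be00; have hD : 0 <= h * (du - b) by rewrite mulr_ge0 //; lra.
  have /eqP : h * (du - b) = 0 by rewrite /be in be00; lra.
  rewrite mulf_eq0 (gt_eqF h0) subr_eq0 //= => /eqP dub; split=> //.
  by move: be00; rewrite /be dub subrr mulr0 add0r; lra.
have gt_sq x : x != 0 -> 0 < x ^+ 2 :> R by move=> ?; rewrite exprn_even_gt0.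
have p0 := sqr_ge0 p; have q0 := sqr_ge0 q.
have [al00|aln0] := eqVneq al 0; have [be00|ben0] := eqVneq be 0.
- exfalso; have [e1 e2] := alP al00; have [e3 _] := beP be00.
  by case/or3P: strict => ?; lra.
- have [e1 e2] := alP al00; rewrite al00 mul0r add0r e2.
  have be_gt0 : 0 < be by rewrite lt_def ben0.
  have [q00|qn0] := eqVneq q 0; last first.
    apply: ltr_wpDr; first by rewrite -{1}e2.
    by apply: mulr_gt0 => //; apply: mulr_gt0 => //; exact: gt_sq.
  rewrite q00 addr0 expr0n /= !mulr0 add0r.
  apply: mulr_gt0; [by apply: mulr_gt0; lra | apply: gt_sq].
  by apply: contraNneq pq0 => ->; rewrite q00.
- have [e1 e2] := beP be00; rewrite be00 mul0r addr0 e2.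
  have al_gt0 : 0 < al by rewrite lt_def aln0.
  have [p00|pn0] := eqVneq p 0; last first.
    apply: ltr_wpDr; first by rewrite -{1}e2.
    by apply: mulr_gt0 => //; apply: mulr_gt0 => //; exact: gt_sq.
  rewrite p00 add0r expr0n /= !mulr0 add0r.
  apply: mulr_gt0; [by apply: mulr_gt0; lra | apply: gt_sq].
  by apply: contraNneq pq0 => ->; rewrite p00.
have al_gt0 : 0 < al by rewrite lt_def aln0.
have be_gt0 : 0 < be by rewrite lt_def ben0.
apply: ltr_wpDr => //; apply: mulr_gt0 => //.
have [p00|pn0] := eqVneq p 0; last first.
  by apply: ltr_wpDr; [apply: mulr_ge0 | apply: mulr_gt0 => //; exact: gt_sq].
apply: ltr_wpDl; [exact: mulr_ge0 | apply: mulr_gt0 => //; apply: gt_sq].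
by apply: contraNneq pq0 => ->; rewrite p00.
Qed.

(** Outside the strict cases the form is a perfect square: (b - 1)^2 (p - q)^2 or b^2 (p + q)^2. *)
Lemma pair_form_ge0 (b dv du c : R) (e : bool) (p q : R) :
  1 < b -> b <= dv -> b <= du -> 0 <= c -> c + e%:R <= dv -> c + e%:R <= du ->
  0 <= pair_form b dv du c e p q.
Proof.
move=> b1 bv bu c0 cv cu.
have [[-> ->]|pq0] := eqVneq (p, q) (0, 0).
  by rewrite /pair_form addr0 subrr expr0n /= !(mulr0, addr0, subr0).
case: e cv cu => [cv cu | ]; last rewrite addr0 => cv cu.
  have [] := boolP [|| b < dv, b < du | 0 < c].
    by move=> strict; apply/ltW/pair_form_adj_gt0.
  rewrite !negb_or -!leNgt => /and3P[vb ub c_le0].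
  have -> : c = 0 by lra.
  have -> : dv = b by lra.
  have -> : du = b by lra.
  have -> : pair_form b b b 0 true p q = (b - 1) ^+ 2 * (p - q) ^+ 2.
    by rewrite /pair_form /=; ring.
  by rewrite mulr_ge0 ?sqr_ge0.
have [] := boolP [|| b < dv, b < du | c < b].
  by move=> strict; apply/ltW/pair_form_nonadj_gt0.
rewrite !negb_or -!leNgt => /and3P[vb ub bc].
have dvb : dv = b by lra.
have dub : du = b by lra.
have -> : c = b by lra.
have -> : pair_form b dv du b false p q = b * b * (p + q) ^+ 2.
  by rewrite /pair_form dvb dub /=; ring.
by apply: mulr_ge0; [apply: mulr_ge0; lra | exact: sqr_ge0].
Qed.

Lemma sum_split_pair (F : G -> R) (v u : G) : v != u ->
  \sum_x F x = F v + F u + \sum_(w | (w != v) && (w != u)) F w.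
Proof. by move=> vu; rewrite (bigD1 v) //= (bigD1 u) 1?eq_sym //= addrA. Qed.

(** Edges avoiding both [v] and [u] contribute nonnegative terms and are dropped. *)
Lemma energy_ge_pair (f : G -> R) (v u : G) : v != u ->
  adj v u * (f v - f u) ^+ 2 +
    \sum_(w | (w != v) && (w != u))
      (adj v w * (f v - f w) ^+ 2 + adj u w * (f u - f w) ^+ 2) <= energy f.
Proof.
move=> vu; pose T x y := adj x y * (f x - f y) ^+ 2.
have T_ge0 x y : 0 <= T x y by rewrite mulr_ge0 ?sqr_ge0 ?ler0n.
have TC x y : T x y = T y x by rewrite /T adjC; ring.
have Txx x : T x x = 0 by rewrite /T subrr expr0n mulr0.
have split2 F := sum_split_pair F vu.
have rest : \sum_(w | (w != v) && (w != u)) (T v w + T u w) <=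
    \sum_(w | (w != v) && (w != u)) \sum_y T w y.
  apply: ler_sum => w _; rewrite split2 (TC v) (TC u) lerDl.
  exact: sumr_ge0.
rewrite -[X in X <= _]/(T v u + \sum_(w | _) (T v w + T u w)).
rewrite /energy -[\sum_x \sum_y _]/(\sum_x \sum_y T x y) split2.
rewrite (split2 (T v)) (split2 (T u)) !Txx (TC u v).
rewrite big_split /= in rest *; lra.
Qed.

Definition common_degree (v u : G) := #|[set w : G | sedge v w && sedge u w]|.

(** The value at [u] is 0 even if [u] is a neighbor of [v], so combinations of the two vectors take
    the values (b - 1) p at [v] and (b - 1) q at [u]. *)
Definition pair_vector (b : R) (v u x : G) : R :=
  if x == v then b - 1 else if x == u then 0 else - adj v x.

Lemma energy_pair_form (b p q : R) (v u : G)
  (f := fun x => p * pair_vector b v u x + q * pair_vector b u v x) : v != u ->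
  pair_form b (degree v)%:R (degree u)%:R (common_degree v u)%:R (sedge v u) p q
    <= energy f - b * sqsum f.
Proof.
move=> vu; have uv := vu; rewrite eq_sym in uv.
have fv : f v = (b - 1) * p by rewrite /f /pair_vector eqxx (negbTE vu); ring.
have fu : f u = (b - 1) * q by rewrite /f /pair_vector eqxx (negbTE uv); ring.
have fw w : w != v -> w != u -> f w = - (p * adj v w + q * adj u w).
  by rewrite /f /pair_vector => /negbTE -> /negbTE ->; ring.
have split2 F := sum_split_pair F vu.
have adjxx x : adj x x = 0 by rewrite /adj sedge_irrefl.
have degv : \sum_(w | (w != v) && (w != u)) adj v w = (degree v)%:R - adj v u.
  by rewrite degreeE split2 adjxx; ring.
have degu : \sum_(w | (w != v) && (w != u)) adj u w = (degree u)%:R - adj v u.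
  by rewrite degreeE split2 adjxx adjC; ring.
have comm : \sum_(w | (w != v) && (w != u)) adj v w * adj u w = (common_degree v u)%:R.
  have -> : (common_degree v u)%:R = \sum_w adj v w * adj u w.
    rewrite /common_degree -sum1_card natr_sum big_mkcond /=.
    apply: eq_bigr => w _; rewrite inE /adj.
    by do 2!case: sedge; rewrite /= ?mulr0 ?mul0r ?mulr1.
  by rewrite split2 !adjxx; ring.
(* A neighbor of [v] alone contributes (b p)^2 - b p^2 = b (b - 1) p^2, and likewise for [u]; a
   common neighbor adds the correction in the last line. *)
have rest : \sum_(w | (w != v) && (w != u))
      (adj v w * (f v - f w) ^+ 2 + adj u w * (f u - f w) ^+ 2)
    - b * \sum_(w | (w != v) && (w != u)) f w ^+ 2
  = b * (b - 1) * (p ^+ 2 * ((degree v)%:R - adj v u) + q ^+ 2 * ((degree u)%:R - adj v u))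
   + (b * (p + q) ^+ 2 - (b - 1) * (p ^+ 2 + q ^+ 2)) * (common_degree v u)%:R.
  rewrite -degv -degu -comm mulrDr !mulrA !mulr_sumr -sumrB -!big_split /=.
  apply: eq_bigr => w /andP[wv wu]; rewrite fv fu fw // /adj.
  by do 2!case: sedge; rewrite /=; ring.
apply: le_trans (lerB (energy_ge_pair f vu) (lexx _)).
have regroup (A S X S' : R) : A + S - b * (X + S') = A - b * X + (S - b * S').
  by ring.
rewrite /sqsum split2 regroup rest fv fu /pair_form.
have -> : (sedge v u)%:R = adj v u by [].
rewrite le_eqVlt; apply/orP; left; apply/eqP.
by ring.
Qed.

(** If adjacent to [v], the vertex [u] is a neighbor of [v] that is not a common one. *)
Lemma common_degree_le (v u : G) : (common_degree v u + sedge v u <= degree v)%N.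
Proof.
rewrite /degree; have [vu|vu] := boolP (sedge v u); last first.
  by rewrite addn0; apply/subset_leq_card/subsetP=> w; rewrite !inE => /andP[].
rewrite [in leqRHS](cardsD1 u) inE vu addnC leq_add2l.
apply/subset_leq_card/subsetP=> w; rewrite !inE => /andP[-> uw]; rewrite andbT.
by apply: contraTneq uw => ->; rewrite sedge_irrefl.
Qed.

Lemma common_degreeC (v u : G) : common_degree v u = common_degree u v.
Proof. by congr #|pred_of_set _|; apply/setP => w; rewrite !inE andbC. Qed.

Section Pair.
Variables (v u : G) (b : R).
Hypotheses (vu : v != u) (b1 : 1 < b).
Hypotheses (bv : b <= (degree v)%:R) (bu : b <= (degree u)%:R).

Let G_gt1 : (1 < #|G|)%N.
Proof. by rewrite -cardsT; apply/card_gt1P; exists v, u; rewrite !inE. Qed.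

Let common_le_v : (common_degree v u)%:R + (sedge v u)%:R <= (degree v)%:R :> R.
Proof. by rewrite -natrD ler_nat common_degree_le. Qed.

Let common_le_u : (common_degree v u)%:R + (sedge v u)%:R <= (degree u)%:R :> R.
Proof. by rewrite -natrD ler_nat common_degreeC sedge_sym common_degree_le. Qed.

Let form_le : exists p q : R, (p, q) != (0, 0) /\ exists2 N, 0 < N &
  pair_form b (degree v)%:R (degree u)%:R (common_degree v u)%:R (sedge v u) p q
  <= (mu R G 2 - b) * N.
Proof.
have [p [q [pq0 le]]] := mu2_plane (pair_vector b v u) (pair_vector b u v) G_gt1.
set f := fun x => _ in le.
exists p, q; split=> //; exists (sqsum f); last first.
  by apply: le_trans (energy_pair_form _ _ _ vu) _; rewrite mulrBl lerB.
have fv : f v = (b - 1) * p by rewrite /f /pair_vector eqxx (negbTE vu); ring.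
have fu : f u = (b - 1) * q.
  by rewrite /f /pair_vector eqxx [u == v]eq_sym (negbTE vu); ring.
have h0 : 0 < b - 1 by rewrite subr_gt0.
(* [mu2_plane] only gives a nonzero coefficient pair; the values at [v] and [u] show that [f] itself
   is nonzero. *)
have fz_gt0 z : f z != 0 -> 0 < sqsum f.
  move=> fz; rewrite /sqsum (bigD1 z) //=; apply: ltr_wpDr.
    by apply: sumr_ge0 => x _; apply: sqr_ge0.
  by rewrite exprn_even_gt0.
have [p0|pn0] := eqVneq p 0; last first.
  by apply: (fz_gt0 v); rewrite fv mulf_neq0 // gt_eqF.
apply: (fz_gt0 u); rewrite fu mulf_neq0 ?(gt_eqF h0) //.
by apply: contraNneq pq0 => ->; rewrite p0.
Qed.

Lemma mu2_ge_of_pair : b <= mu R G 2.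
Proof.
have [p [q [pq0 [N N0 le]]]] := form_le.
rewrite -subr_ge0 -(pmulr_lge0 _ N0); apply: le_trans le.
exact: pair_form_ge0.
Qed.

Lemma mu2_gt_of_pair :
  [|| b < (degree v)%:R, b < (degree u)%:R |
      if sedge v u then (0 < common_degree v u)%N else (common_degree v u)%:R < b] ->
  b < mu R G 2.
Proof.
move=> strict; have [p [q [pq0 [N N0 le]]]] := form_le.
rewrite -subr_gt0 -(pmulr_lgt0 _ N0); apply: lt_le_trans le.
move: strict common_le_v common_le_u; case: sedge => strict cv cu.
  by apply: pair_form_adj_gt0; rewrite ?ltr0n.
by rewrite !addr0 in cv cu; apply: pair_form_nonadj_gt0.
Qed.
End Pair.

End TestPlanes.

(** * Degrees and edges *)

Section Combinatorics.
Local Open Scope nat_scope.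

(* Here n is the order, e is the degree sum minus n k, and T is the sum of
   k - d(u) over the vertices u other than v; see ex_heavy_edge. *)
Lemma heavy_bound_top (n T e : nat) : 0 < e -> e + 3 <= n ->
  n * n < (n * T + n.-1 * e) * (2 * (n - e)).
Proof.
move=> e0 en; have [a a3 ->] : exists2 a, 3 <= a & n = a + e by exists (n - e); lia.
have [N N3 NE] : exists2 N, 3 <= N & a + e = N.+1 by exists (a + e).-1; lia.
(* From (e - 1)(a - 1) >= 0. Then the right side is at least 2 N^2, which exceeds (N + 1)^2 as N >=
   3. *)
have ea : N <= e * a.
  have : 0 <= (e - 1) * (a - 1) by [].
  by rewrite mulnBl mulnBr; nia.
rewrite addnK NE /=.
apply: (@leq_trans (2 * (N * N))); first by nia.
by rewrite mulnDl; apply: (leq_trans _ (leq_addl _ _)); nia.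
Qed.

(** The last factor is at least 5, and 5 n T >= 5 n (n - 1) / 2 exceeds n^2. *)
Lemma heavy_bound_below (n T e : nat) : n.-1 <= 2 * T -> 5 + 2 * e <= n ->
  n * n < (n * T + n.-1 * e) * (n - 2 * e).
Proof.
move=> nT en; apply: (@leq_trans (n * T * 5)).
  have : n * n.-1 <= n * (2 * T) by rewrite leq_mul2l nT orbT.
  have [N ->] : exists N, n = N.+1 by exists n.-1; lia.
  by rewrite /=; nia.
by apply: leq_mul; [exact: leq_addr | lia].
Qed.

Variable G : sgraph.

(** Ordered adjacent pairs are counted by first vertex and by underlying edge; each edge has two
    orderings. *)
Lemma sum_degree : \sum_(x : G) degree x = 2 * #|edge_set G|.
Proof.
pose E := [set p : G * G | sedge p.1 p.2].
have -> : \sum_(x : G) degree x = #|E|.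
  rewrite -sum1_card (eq_bigl (fun p => sedge p.1 p.2)) => [|p]; last by rewrite inE.
  rewrite -(pair_big_dep xpredT (fun x y => sedge x y) (fun _ _ => 1)) /=.
  by apply: eq_bigr => x _; rewrite sum1dep_card.
rewrite -sum1_card (partition_big (fun p => [set p.1; p.2]) (mem (edge_set G))) /=; last first.
  move=> [x y]; rewrite !inE /= => xy.
  by apply/existsP; exists x; apply/existsP; exists y; rewrite xy /=.
rewrite mulnC -sum_nat_const; apply: eq_bigr => A.
rewrite inE => /existsP[x /existsP[y /andP[xy /eqP ->]]].
have xny : x != y by apply: contraTneq xy => ->; rewrite sedge_irrefl.
rewrite sum1dep_card -[RHS](_ : #|[set (x, y); (y, x)]| = 2); last first.
  by rewrite cards2 xpair_eqE (negbTE xny).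
congr #|pred_of_set _|; apply/setP => -[a b]; rewrite !inE !xpair_eqE /=.
apply/andP/orP => [[ab /eqP eqAB]|[]/andP[/eqP -> /eqP ->]]; last 2 first.
- by [].
- by rewrite sedge_sym setUC.
have : a \in [set x; y] by rewrite -eqAB set21.
have : b \in [set x; y] by rewrite -eqAB set22.
rewrite !inE => /orP[]/eqP bE /orP[]/eqP aE; move: ab; rewrite aE bE ?sedge_irrefl ?eqxx //=; auto.
Qed.

Lemma iso_complete_bipartite (A : {set G}) (r s : nat) :
  #|A| = r -> #|~: A| = s ->
  (forall x y, sedge x y = ((x \in A) != (y \in A))) ->
  isomorphic G (complete_bipartite r s).
Proof.
move=> <- <- edgeE.
pose g (z : 'I_#|A| + 'I_#|~: A|) : G :=
  match z with inl i => enum_val i | inr j => enum_val j end.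
have gA i : g (inl i) \in A by exact: enum_valP.
have gC j : g (inr j) \notin A by have := enum_valP j; rewrite inE.
have g_inj : injective g.
  move=> [i|j] [i'|j'] e.
  - by congr inl; apply: enum_val_inj.
  - by have := gC j'; rewrite -e gA.
  - by have := gC j; rewrite e gA.
  - by congr inr; apply: enum_val_inj.
have [|f gK fK] := inj_card_bij g_inj.
  by rewrite card_sum !card_ord cardsC.
exists f; first by exists g.
move=> x y; rewrite -{2}(fK x) -{2}(fK y) edgeE.
by case: (f x) (f y) => [i|j] [i'|j'] /=; rewrite ?gA ?(negbTE (gC _)).
Qed.

Hypothesis G_conn : connected G.

Lemma ex_neighbor (x v : G) : x != v -> exists y, sedge x y.
Proof.
move=> xv; have /connectP[[|y p] /= xp vE] := G_conn.2 x v.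
  by rewrite vE eqxx in xv.
by exists y; case/andP: xp.
Qed.

(** If every edge met [v], connectedness would join all other vertices to [v] and to nothing else: a
    star. *)
Lemma ex_edge_avoiding (v : G) :
  ~ isomorphic G (complete_bipartite 1 #|G|.-1) ->
  exists u w, [/\ u != v, w != v & sedge u w].
Proof.
move=> not_star.
case: (boolP [exists u, exists w, [&& u != v, w != v & sedge u w]]).
  by case/existsP=> u /existsP[w /and3P[]]; exists u, w.
move=> none; case: not_star.
have no_edge u w : u != v -> w != v -> sedge u w = false.
  move=> uv wv; apply: contraNF none => uw.
  by apply/existsP; exists u; apply/existsP; exists w; rewrite uv wv.
have edge_v x : x != v -> sedge x v.
  move=> xv; have [y xy] := ex_neighbor xv.
  by have [<- //|yv] := eqVneq y v; rewrite no_edge in xy.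
apply: (iso_complete_bipartite (A := [set v])); rewrite ?cards1 ?cardsC1 //.
move=> x y; rewrite !inE.
have [->|xv] := eqVneq x v; have [->|yv] := eqVneq y v.
- exact: sedge_irrefl.
- by rewrite sedge_sym edge_v.
- by rewrite edge_v.
- exact: no_edge.
Qed.

(** An edge avoiding [v] whose ends both had degree 1 would be a whole component, cut off from
    [v]. *)
Lemma ex_degree_gt1 (v : G) :
  ~ isomorphic G (complete_bipartite 1 #|G|.-1) ->
  exists2 x, x != v & 1 < degree x.
Proof.
move=> /(ex_edge_avoiding v)[u [w [uv wv uw]]].
have [du|] := leqP (degree u) 1; last by exists u.
have [dw|] := leqP (degree w) 1; last by exists w.
have same_nbr (x y z : G) : degree x <= 1 -> sedge x y -> sedge x z -> y = z.
  by move=> /card_le1_eqP d xy xz; apply: d; rewrite inE.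
have /closed_connect/(_ _ _ (G_conn.2 u v)) : closed (@sedge G) [set u; w].
  apply: intro_closed; first exact/sym_connect_sym/sedge_sym.
  move=> x y xy; rewrite !inE => /orP[]/eqP xE; move: xy; rewrite xE => xy.
    by rewrite (same_nbr _ _ _ du xy uw) eqxx orbT.
  by rewrite (same_nbr _ _ u dw xy) ?eqxx // sedge_sym.
by rewrite !inE eqxx /= ![v == _]eq_sym (negbTE uv) (negbTE wv).
Qed.

(** All degrees are positive and one exceeds 1. This makes the average degree b exceed 1, as the
    test planes require. *)
Lemma card_lt_sum_degree : ~ isomorphic G (complete_bipartite 1 #|G|.-1) ->
  #|G| < \sum_(x : G) degree x.
Proof.
move=> not_star; have /card_gt0P[v _] := G_conn.1.
have [x xv x1] := ex_degree_gt1 v not_star.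
have deg_gt0 (y : G) : 0 < degree y.
  have [z yz] : exists z, sedge y z.
    have [->|yv] := eqVneq y v; last exact: ex_neighbor yv.
    by apply: (@ex_neighbor v x); rewrite eq_sym.
  by apply/card_gt0P; exists z; rewrite inE.
rewrite -sum1_card (bigD1 x) //= [ltnRHS](bigD1 x) //= -addSn.
by apply: leq_add => //; apply: leq_sum.
Qed.

(** * A heavy edge when only one vertex has large degree *)

Section OneLargeDegree.
Variables (v : G) (m : nat).
Local Notation n := #|G|.
Hypothesis not_star : ~ isomorphic G (complete_bipartite 1 n.-1).
Hypothesis sum_deg : \sum_(x : G) degree x = m.
Hypothesis small_deg : forall u, u != v -> n * degree u < m.

Lemma degree_lt (x : G) : degree x < n.
Proof.
rewrite -cardsT; apply/proper_card/properP; split; first exact/subsetT.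
by exists x; rewrite inE // sedge_irrefl.
Qed.

Let k := \max_(u : G | u != v) degree u.
Let low j := [set w : G | (w != v) && (degree w <= j)].
Let top := [set u : G | (u != v) && (degree u == k)].

Let deg_le_k u : u != v -> degree u <= k.
Proof. by move=> uv; rewrite /k (leq_bigmax_cond (F := @degree G)). Qed.

Let k_gt1 : 1 < k.
Proof.
have [x xv x1] := ex_degree_gt1 v not_star.
exact: leq_trans x1 (deg_le_k xv).
Qed.

(** Double counting of the edges from [top] to [low j]: a vertex of [top] loses at most the neighbor
    [v], and a vertex of [low j] has at most j neighbors. *)
Let count_top j :
  (forall u w, u \in top -> w != v -> sedge u w -> degree w <= j) ->
  #|top| * k.-1 <= #|low j| * j.
Proof.
move=> nbr_low.
apply: (@leq_trans (\sum_(u in top) \sum_(w in low j) sedge u w)).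
  rewrite -sum_nat_const; apply: leq_sum => u u_top.
  have : #|[set w | sedge u w]| <= #|v |: [set w in low j | sedge u w]|.
    apply/subset_leq_card/subsetP => w; rewrite !inE => uw.
    by have [//|wv] := eqVneq w v; rewrite uw (nbr_low u w).
  have -> : #|[set w | sedge u w]| = k by move: u_top; rewrite inE => /andP[_ /eqP].
  rewrite cardsU1 => le_k.
  have -> : \sum_(w in low j) sedge u w = #|[set w in low j | sedge u w]|.
    by rewrite -sum1dep_card big_mkcondr; apply: eq_bigr => w _; case: sedge.
  by move: le_k; case: (_ \notin _) => /=; lia.
rewrite exchange_big -sum_nat_const; apply: leq_sum => w.
rewrite inE => /andP[_]; apply: leq_trans.
rewrite /degree -sum1dep_card [leqRHS]big_mkcond [leqLHS]big_mkcond /=.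
by apply: leq_sum => u _; rewrite sedge_sym; case: ifP; case: sedge.
Qed.

(* The inequality is n^2 times the hypothesis of mu2_gt_of_edge at b = m / n,
   with m the sum of the degrees. *)
Lemma ex_heavy_edge : exists u w, [/\ u != v, w != v, sedge u w &
  n * n < (n * degree v - m) * (n * (degree u + degree w + 2) - 2 * m)].
Proof.
have n_gt0 : 0 < n := G_conn.1.
have [u0 [w0 [u0v w0v _]]] := ex_edge_avoiding v not_star.
have [t tv tk] : {t : G | t != v & degree t = k}.
  have others : 0 < #|[pred u | u != v]| by apply/card_gt0P; exists u0.
  by have [t tv tE] := eq_bigmax_cond (@degree G) others; exists t.
have nk_lt : n * k < m by rewrite -tk small_deg.
pose T := \sum_(u | u != v) (k - degree u).
have TE : T + \sum_(u | u != v) degree u = n.-1 * k.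
  rewrite /T -big_split /= (eq_bigr (fun=> k)) => [|u uv]; last by rewrite subnK // deg_le_k.
  by rewrite sum_nat_const; congr (_ * _); rewrite -(cardC1 v); apply: eq_card.
have mE : degree v + \sum_(u | u != v) degree u = m by rewrite -sum_deg [RHS](bigD1 v).
have Dn := degree_lt v.
(* A vertex of degree k - 1 adds 1 to [T], and one of degree at most k - 2 adds at least 2. *)
have T_ge : #|low k.-1| + #|low k.-2| <= T.
  rewrite -!sum1dep_card !big_mkcondr -big_split /=.
  apply: leq_sum => u uv; have := k_gt1.
  by case: (leqP (degree u) k.-1); case: (leqP (degree u) k.-2) => /=; lia.
have top_low : #|top| + #|low k.-1| = n.-1.
  rewrite -(cardC1 v) -(cardID [pred u | degree u == k] (predC1 v)).
  congr (_ + _); apply: eq_card => u; rewrite !inE;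
    have [->|uv] /= := eqVneq u v; rewrite ?andbF ?andbT //.
  by have := deg_le_k uv; have := k_gt1; lia.
have top_gt0 : 0 < #|top| by apply/card_gt0P; exists t; rewrite inE tv tk eqxx.
have k1 := k_gt1.
have [e e_gt0 eE] : exists2 e, 0 < e & m = n * k + e by exists (m - n * k); lia.
have n_split : n = n.-1.+1 by rewrite prednK.
have DE : degree v = T + k + e.
  by move: TE mE; rewrite {}eE; rewrite [in n * k]n_split mulSn; lia.
have large_v : n * degree v - m = n * T + n.-1 * e.
  have ne : n * e = n.-1 * e + e by rewrite -[in LHS](prednK n_gt0) mulSn addnC.
  by rewrite DE eE !mulnDr ne; move: (n * T) (n * k) (n.-1 * e) => *; lia.
pose edge_top j := [exists u in top, exists w, [&& w != v, sedge u w & degree w == j]].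
have edge_topP j : edge_top j -> exists u w,
    [/\ u != v, w != v, sedge u w & degree u = k /\ degree w = j].
  case/existsP=> u /andP[]; rewrite inE => /andP[uv /eqP uk].
  by case/existsP=> w /and3P[wv uw /eqP wj]; exists u, w.
have no_edge_top j : (forall u w, u \in top -> w != v -> sedge u w -> degree w <= j.+1) ->
    ~~ edge_top j.+1 ->
    (forall u w, u \in top -> w != v -> sedge u w -> degree w <= j).
  move=> le_j none u w u_top wv uw; rewrite -ltnS ltn_neqAle (le_j u w) // andbT.
  apply: contraNN none => wj; apply/existsP; exists u; rewrite u_top /=.
  by apply/existsP; exists w; rewrite wv uw.
have top_le_k u w : u \in top -> w != v -> sedge u w -> degree w <= k.-2.+2.
  by move=> _ /deg_le_k + _; lia.
have kE : k = k.-2.+2 by lia.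
(* Edge inside [top]: d(v) = T + k + e < n and k > 1 give [e + 3 <= n]. *)
have [/edge_topP[u [w [uv wv uw [uk wk]]]]|no_kk] := boolP (edge_top k.-2.+2).
  exists u, w; split=> //; rewrite large_v uk wk -kE eE.
  have -> : n * (k + k + 2) - 2 * (n * k + e) = 2 * (n - e).
    by rewrite !mulnDr; move: (n * k) => *; lia.
  by apply: heavy_bound_top; lia.
have top_le_k1 := no_edge_top _ top_le_k no_kk.
(* With no edge inside [top], at least half of the vertices other than [v] lie below k, so
   [n.-1 <= 2 * T]; with d(v) < n this yields [5 + 2 * e <= n]. *)
have le_top : #|top| <= #|low k.-1|.
  have := count_top (j := k.-1); rewrite leq_pmul2r; last by lia.
  by apply => u w ut wv uw; have := top_le_k1 u w ut wv uw; lia.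
have [/edge_topP[u [w [uv wv uw [uk wk]]]]|no_kk1] := boolP (edge_top k.-2.+1).
  exists u, w; split=> //; rewrite large_v uk wk eE.
  have -> : n * (k + k.-2.+1 + 2) - 2 * (n * k + e) = n - 2 * e.
    have -> : k + k.-2.+1 + 2 = k + k + 1 by lia.
    by rewrite !mulnDr muln1; move: (n * k) => *; lia.
  by apply: heavy_bound_below; lia.
(* [T_ge] and T < n - 1 give this strict inequality. If [top] had no edge to degree k - 1 either,
   [count_top] at k - 2 would contradict it. *)
have low_lt_top : #|low k.-2| < #|top| by lia.
have := count_top (no_edge_top _ top_le_k1 no_kk1).
have -> : k.-1 = k.-2.+1 by lia.
have := leq_mul (ltnW low_lt_top) (leqnn k.-2); rewrite mulnS.
by move: (_ * k.-2) (_ * k.-2) => *; lia.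
Qed.
End OneLargeDegree.
End Combinatorics.

(** * Average degree and the second eigenvalue *)

Section SecondEigenvalue.
Variables (R : rcfType) (G : sgraph).
Local Notation n := #|G|.
Local Notation m := #|edge_set G|.
Local Notation avg := ((2 * m)%:R / n%:R : R).
Hypothesis G_conn : connected G.
Hypothesis not_star : ~ isomorphic G (complete_bipartite 1 n.-1).

Let n_gt0 : (0 < n)%N := G_conn.1.
Let nR_gt0 : 0 < n%:R :> R. Proof. by rewrite ltr0n. Qed.

Lemma avg_gt1 : 1 < avg.
Proof.
by rewrite ltr_pdivlMr // mul1r ltr_nat -sum_degree card_lt_sum_degree.
Qed.

Lemma avg_le_degree (x : G) : (avg <= (degree x)%:R) = (2 * m <= n * degree x)%N.
Proof. by rewrite ler_pdivrMr // -natrM ler_nat (mulnC n). Qed.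

Lemma avg_lt_degree (x : G) : (avg < (degree x)%:R) = (2 * m < n * degree x)%N.
Proof. by rewrite ltr_pdivrMr // -natrM ltr_nat (mulnC n). Qed.

Lemma mu2_gt_of_one_large (v : G) :
  (forall u, u != v -> (n * degree u < 2 * m)%N) -> avg < mu R G 2.
Proof.
move=> small.
have [u [w [uv wv uw heavy]]] := ex_heavy_edge G_conn not_star (sum_degree G) small.
(* A positive product means that neither natural subtraction is truncated, so both transfer to
   [R]. *)
have : (0 < (n * degree v - 2 * m) * (n * (degree u + degree w + 2) - 2 * (2 * m)))%N.
  exact: leq_ltn_trans heavy.
rewrite muln_gt0 !subn_gt0 => /andP[v_large uw_large].
apply: (mu2_gt_of_edge uv wv uw); first by rewrite avg_lt_degree.
rewrite -(ltr_nat R) !natrM natrB ?(ltnW v_large) // natrB ?(ltnW uw_large) // in heavy.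
rewrite -(ltr_pM2l (mulr_gt0 nR_gt0 nR_gt0)) mulr1; apply: lt_le_trans heavy _.
rewrite !natrM !natrD le_eqVlt; apply/orP; left; apply/eqP.
by field; rewrite gt_eqF.
Qed.

Lemma mu2_gt_or_two_large : avg < mu R G 2 \/
  exists v u : G, [/\ v != u, avg <= (degree v)%:R & avg <= (degree u)%:R].
Proof.
have [/existsP[v /forallP small]|none] :=
    boolP [exists v : G, forall u, (u != v) ==> (n * degree u < 2 * m)%N].
  by left; apply: (@mu2_gt_of_one_large v) => u; apply/implyP.
right; have large (v : G) : exists2 u, u != v & avg <= (degree u)%:R.
  move: none => /existsPn/(_ v)/forallPn[u]; rewrite negb_imply -leqNgt => /andP[uv le].
  by exists u; rewrite ?avg_le_degree.
have /card_gt0P[x _] := n_gt0.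
by have [v _ bv] := large x; have [u uv bu] := large v; exists u, v.
Qed.

Lemma avg_le_mu2 : avg <= mu R G 2.
Proof.
have [/ltW //|[v [u [vu bv bu]]]] := mu2_gt_or_two_large.
exact: mu2_ge_of_pair vu avg_gt1 bv bu.
Qed.

(** * The equality case *)

Section Equality.
Hypothesis mu2E : mu R G 2 = avg.

(** A vertex above the average, paired with another of at least average degree, would make mu_2 too
    large. So no degree exceeds the average, and summation forces equality. *)
Lemma eq_regular (x : G) : (degree x)%:R = avg.
Proof.
have [|[v [u [vu bv bu]]]] := mu2_gt_or_two_large; first by rewrite mu2E ltxx.
have deg_le (y : G) : (n * degree y <= 2 * m)%N.
  rewrite leqNgt -avg_lt_degree; apply/negP => by_.
  have [z zy bz] : exists2 z, y != z & avg <= (degree z)%:R.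
    by have [yv|] := eqVneq y v; [exists u; rewrite // yv | exists v].
  have := mu2_gt_of_pair zy avg_gt1 (ltW by_) bz.
  by rewrite by_ mu2E ltxx => /(_ isT).
have /eqP : (\sum_(y : G) (2 * m - n * degree y) = 0)%N.
  apply/eqP; rewrite -(eqn_add2r (\sum_(y : G) n * degree y)%N) -big_split /= add0n.
  rewrite (eq_bigr (fun=> (2 * m)%N)) => [|y _]; last by rewrite subnK.
  by rewrite sum_nat_const -big_distrr /= sum_degree.
rewrite sum_nat_eq0 => /forallP/(_ x) /=; rewrite subn_eq0 -avg_le_degree => le.
by apply/le_anti; rewrite le andbT leNgt avg_lt_degree -leqNgt.
Qed.

(** In the regular case these are the only values for which [mu2_gt_of_pair] is not strict: no
    triangles, and equal neighborhoods for nonadjacent vertices. *)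
Lemma eq_common_degree (x y : G) : x != y ->
  common_degree x y = if sedge x y then 0%N else degree x.
Proof.
move=> xy; have bx := eq_regular x; have by_ := eq_regular y.
have := mu2_gt_of_pair xy avg_gt1; rewrite bx by_ => /(_ (lexx _) (lexx _)).
rewrite mu2E ltxx /= => not_strict.
apply/eqP; case: ifP not_strict => [_|xyF] not_strict.
  by rewrite -leqn0 leqNgt; apply/negP => /not_strict.
rewrite eqn_leq; apply/andP; split.
  by have := common_degree_le x y; rewrite xyF addn0.
by rewrite leqNgt; apply/negP; rewrite -(ltr_nat R) bx => /not_strict.
Qed.

(** With B the neighborhood of [v], each vertex outside B shares the neighborhood B, and an edge
    inside B would close a triangle with [v]. *)
Lemma eq_complete_bipartite :
  ~~ odd n /\ isomorphic G (complete_bipartite n./2 n./2).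
Proof.
have /card_gt0P[v _] := n_gt0.
pose B := [set y : G | sedge v y].
have nbr_v x : x \notin B -> forall y, sedge x y = (y \in B).
  have [-> _ y|xv xB y] := eqVneq x v; first by rewrite inE.
  rewrite inE in xB; have vx : v != x by rewrite eq_sym.
  have := eq_common_degree vx; rewrite (negbTE xB) => common_v.
  have xy : degree x = degree v by apply/eqP; rewrite -(eqr_nat R) !eq_regular.
  have common_x := common_v; rewrite common_degreeC -xy in common_x.
  have sub (a b : G) : common_degree a b = degree a -> sedge a y -> sedge b y.
    move=> e; have : [set w | sedge a w && sedge b w] == [set w | sedge a w].
      rewrite eqEcard -/(common_degree a b) e leqnn andbT.
      by apply/subsetP => w; rewrite !inE => /andP[].
    by move=> /eqP/setP/(_ y); rewrite !inE => + ay; rewrite ay.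
  by rewrite inE; apply/idP/idP; apply: sub.
have edgeE x y : sedge x y = ((x \in B) != (y \in B)).
  have [xB|xB] := boolP (x \in B); last by rewrite nbr_v //; case: (y \in B).
  have [yB|yB] := boolP (y \in B); last by rewrite sedge_sym nbr_v // xB.
  apply/negP => xy; rewrite inE in xB; rewrite inE in yB.
  have vx : v != x by apply: contraTneq xB => ->; rewrite sedge_irrefl.
  have := eq_common_degree vx; rewrite xB => /eqP; rewrite cards_eq0 => /eqP/setP/(_ y).
  by rewrite !inE yB xy.
have degE (x : G) : degree x = degree v by apply/eqP; rewrite -(eqr_nat R) !eq_regular.
have cardB : #|B| = degree v by [].
have [x xB] : exists x, x \in B.
  apply/card_gt0P; rewrite cardB -(ltr_nat R) eq_regular.
  by apply: lt_trans avg_gt1; rewrite ltr01.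
(* The complement of B is the neighborhood of any [x] in B, so regularity fixes its size. *)
have cardC : #|~: B| = degree v.
  rewrite -(degE x); congr #|pred_of_set _|; apply/setP => y.
  by rewrite in_setC [RHS]inE edgeE xB; case: (y \in B).
have nE : n = (degree v).*2 by rewrite -(cardsC B) cardB cardC addnn.
rewrite nE odd_double doubleK; split=> //.
exact: iso_complete_bipartite cardB cardC edgeE.
Qed.
End Equality.
End SecondEigenvalue.

(** * Balanced complete bipartite graphs attain the bound *)

Section BalancedCompleteBipartite.
Variables (R : rcfType) (G : sgraph) (h : nat).
Hypothesis iso : isomorphic G (complete_bipartite h h).

Lemma balanced_parts : exists A : {set G},
  forall x y, sedge x y = ((x \in A) != (y \in A)) /\ degree x = h.
Proof.
have [f f_bij f_mono] := iso.
exists [set x | if f x is inl _ then true else false] => x y; split.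
  by rewrite -f_mono !inE /=; case: (f x) (f y) => [?|?] [?|?].
have [g gK fK] := f_bij.
have -> : degree x = #|[set z | Krs_rel (f x) z]|.
  rewrite /degree -(card_imset _ (bij_inj f_bij)); congr #|pred_of_set _|.
  apply/setP => z; rewrite inE; apply/imsetP/idP => [[y']|fz].
    by rewrite inE -f_mono => ? ->.
  by exists (g z); rewrite ?fK // inE -f_mono fK.
case: (f x) => [i|j].
  have -> : [set z | Krs_rel (inl i) z] = (@inr 'I_h 'I_h) @: setT.
    apply/setP => -[a|a]; rewrite inE /=; last by rewrite imset_f ?inE.
    by apply/esym/imsetP => -[].
  by rewrite card_imset ?cardsT ?card_ord // => ? ? [].
have -> : [set z | Krs_rel (inr j) z] = (@inl 'I_h 'I_h) @: setT.
  apply/setP => -[a|a]; rewrite inE /=; first by rewrite imset_f ?inE.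
  by apply/esym/imsetP => -[].
by rewrite card_imset ?cardsT ?card_ord // => ? ? [].
Qed.

(** If [f] sums to 0 over one part, the adjacency form, twice the product of the two part sums,
    vanishes, and the energy is h times [sqsum f]. *)
Lemma mu2_balanced_le : (1 < #|G|)%N -> mu R G 2 <= h%:R.
Proof.
move=> n1; have [A edgeE] := balanced_parts.
pose l x : R := (x \in A)%:R.
apply: (@mu2_le R G l) => // f lf.
rewrite energyE (_ : \sum_x \sum_y _ = 0); last first.
  pose S := \sum_x f x.
  have inner x : \sum_y adj R x y * (f x * f y) = l x * f x * S.
    (* The subtracted term is zero by [lf]; it makes the identity hold for each [y] separately. *)
    transitivity (l x * f x * S - (2 * l x - 1) * f x * \sum_y l y * f y); last first.
      by rewrite lf mulr0 subr0.
    rewrite /S !mulr_sumr -sumrB.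
    apply: eq_bigr => y _; rewrite /adj (edgeE x y).1 /l.
    by case: (x \in A); case: (y \in A) => /=; ring.
  under eq_bigr => x _ do rewrite inner.
  by rewrite -mulr_suml lf mul0r.
rewrite subr0 /sqsum mulr_sumr; apply: ler_sum => x _.
by rewrite (edgeE x x).2.
Qed.

Lemma balanced_avg : (0 < #|G|)%N ->
  (2 * #|edge_set G|)%:R / #|G|%:R = h%:R :> R.
Proof.
move=> n0; have [A edgeE] := balanced_parts.
rewrite -sum_degree (eq_bigr (fun=> h)) => [|x _]; last exact: (edgeE x x).2.
by rewrite sum_nat_const natrM mulrAC divff ?mul1r // pnatr_eq0 -lt0n.
Qed.
End BalancedCompleteBipartite.

Theorem theorem3p4 (R : rcfType) (G : sgraph) (n m : nat)
    (connG : connected G)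
    (orderG : #|G| = n)
    (sizeG : #|edge_set G| = m)
    (not_star : ~ isomorphic G (complete_bipartite 1 n.-1)) :
  (2 * m)%:R / n%:R <= mu R G 2 /\
  (mu R G 2 = (2 * m)%:R / n%:R <->
   ~~ odd n /\ isomorphic G (complete_bipartite n./2 n./2)).
Proof.
subst n m; have lower := avg_le_mu2 R connG not_star.
split=> //; split=> [mu2E|[_ iso]]; first exact: eq_complete_bipartite mu2E.
apply/le_anti; rewrite lower andbT (balanced_avg R iso) ?mu2_balanced_le //; last exact: connG.1.
(* The one-vertex graph is the star [complete_bipartite 1 0], so [not_star] yields a second
   vertex. *)
have /card_gt0P[v _] := connG.1.
have [x xv _] := ex_degree_gt1 connG v not_star.
by rewrite -cardsT; apply/card_gt1P; exists x, v; rewrite !inE.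
Qed.
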